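(* Let $n$ be a positive integer and let $f\in\mathbb{R}[x_1,\ldots,x_{n+1}]$ be a linear polynomial (i.e. of the form $f=\sum_{i=1}^{n+1}a_ix_i+c$ with $a_i,c\in\mathbb{R}$ and the $a_i$ not all zero). Then $f$ is a first integral of some polynomial vector fields on $\mathbb{S}^n$.
   Context: $\mathbb{S}^n=\{x\in\mathbb{R}^{n+1} : \sum_i x_i^2=1\}$. A polynomial vector field $\chi=(P_1,\ldots,P_{n+1})$ in $\mathbb{R}^{n+1}$ is identified with the operator $\sum_i P_i\,\partial/\partial x_i$. It is a vector field on $\mathbb{S}^n$ if $\chi(\sum_i x_i^2-1)=K(\sum_i x_i^2-1)$ for some real polynomial $K$. A first integral of $\chi$ on an open set $U\subset\mathbb{R}^{n+1}$ is a non-constant smooth map $G:U\to\mathbb{R}$ that is constant along all solution curves of $\dot x_i=P_i$ contained in $U$; equivalently, $\chi G=0$ on $U$. Here $U=\mathbb{R}^{n+1}$. *)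

(* Defs.v *)
(* [mpoly] is imported without its notations, which clash with those of
   MathComp-Analysis. *)
From HB Require Import structures.
From mathcomp Require Import all_boot all_order all_algebra.
From mathcomp Require Import all_classical all_reals all_analysis.
From mathcomp Require mpoly.
Import (canonicals) mpoly.

Set Implicit Arguments.
Unset Strict Implicit.
Unset Printing Implicit Defensive.

Import Order.TTheory GRing.Theory Num.Theory.
Import numFieldNormedType.Exports.

Local Open Scope classical_set_scope.
Local Open Scope ring_scope.

Definition mvar (R : realType) (m : nat) (i : 'I_m) : mpoly.mpoly m R :=
  mpoly.mpolyX R (mpoly.mnm1 i).

Definition mconst (R : realType) (m : nat) (c : R) : mpoly.mpoly m R :=
  mpoly.mpolyC m c.

Definition peval (R : realType) (m : nat) (p : mpoly.mpoly m R)
  (x : 'rV[R]_m) : R := mpoly.meval (fun i => x 0 i) p.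

Definition vfield (R : realType) (m : nat) := 'I_m -> mpoly.mpoly m R.

Definition vf_apply (R : realType) (m : nat) (chi : vfield R m)
  (g : mpoly.mpoly m R) : mpoly.mpoly m R :=
  \sum_(i < m) chi i * mpoly.mderiv i g.

Definition sphere_poly (R : realType) (n : nat) : mpoly.mpoly n.+1 R :=
  (\sum_(i < n.+1) mvar R i ^+ 2) - 1.

Definition vfield_on_sphere (R : realType) (n : nat) (chi : vfield R n.+1) :=
  exists K : mpoly.mpoly n.+1 R,
    vf_apply chi (sphere_poly R n) = K * sphere_poly R n.

Definition linear_poly (R : realType) (m : nat) (f : mpoly.mpoly m R) :=
  exists (a : 'I_m -> R) (c : R),
    (exists i, a i != 0) /\
    f = (\sum_(i < m) mconst m (a i) * mvar R i) + mconst m c.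

Fixpoint iter_partial (R : realType) (m : nat) (s : seq 'I_m)
  (G : 'rV[R]_m -> R) : 'rV[R]_m -> R :=
  if s is i :: s' then fun x => 'D_(delta_mx 0 i) (iter_partial s' G) x else G.

(* C^oo on an open set: all iterated partial derivatives, of every order and in
   every order of differentiation, exist and are continuous on [U]. Derivability
   has to be required explicitly since ['D_v] is a total operator. *)
Definition smooth_on (R : realType) (m : nat) (U : set 'rV[R]_m)
  (G : 'rV[R]_m -> R) :=
  forall (s : seq 'I_m) (x : 'rV[R]_m), U x ->
    {for x, continuous (iter_partial s G)} /\
    (forall i, derivable (iter_partial s G) x (delta_mx 0 i)).

(* A solution curve of x_i' = P_i(x) is given on an open interval [J] of time,
   bounded or not; the values of [gamma] outside [J] are irrelevant. *)
Definition solution_curve (R : realType) (m : nat) (chi : vfield R m)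
  (J : set R) (gamma : R -> 'rV[R]_m) :=
  [/\ open J, is_interval J &
      forall t, J t -> forall i : 'I_m,
        is_derive t 1 (fun s => gamma s 0 i) (peval (chi i) (gamma t))].

(* The values of [G] outside [U] are irrelevant. *)
Definition first_integral (R : realType) (m : nat) (chi : vfield R m)
  (U : set 'rV[R]_m) (G : 'rV[R]_m -> R) :=
  [/\ open U,
      exists x y, [/\ U x, U y & G x <> G y],
      smooth_on U G &
      forall (J : set R) (gamma : R -> 'rV[R]_m),
        solution_curve chi J gamma -> (forall t, J t -> U (gamma t)) ->
        forall s t, J s -> J t -> G (gamma s) = G (gamma t)].

(* Main.v *)
Require Import Defs.
From mathcomp Require Import all_boot all_order all_algebra.
From mathcomp Require Import all_classical all_reals all_analysis.
From mathcomp Require mpoly.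
Import (canonicals) mpoly.

(** Write [f = a_1 x_1 + ... + a_(n+1) x_(n+1) + c] and [S = |x|^2 - 1]. Since
    [n + 1 >= 2], some constant vector [w <> 0] is orthogonal to [a]; the field
    used is [chi = S w].

    It is tangent to the sphere for a reason that has nothing to do with [w]: a
    derivation multiplied by [S] sends [S] to a multiple of [S]
    ([vfield_on_sphere_times]). Such a field vanishes on the sphere itself, and
    for [n = 1] this is unavoidable: a field that annihilates [f] is a multiple
    [p w] of [w], and [S] divides [p w(S) = 2 p (w_1 x_1 + w_2 x_2)] only if it
    divides [p], because [S] is irreducible of degree two. Multiplying by [S] is
    thus the choice that works in every dimension.

    It annihilates [f] because the gradient of [f] is the constant vector [a],
    and [a . (S w) = S (a . w) = 0]. Along a solution curve the derivative of
    [f] is therefore zero, and a function with zero derivative on an interval is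
    constant ([solution_curve_affine_fun], [constant_on_interval]). Smoothness
    comes from the fact that the partial derivatives of an affine function are
    again affine ([smooth_affine_fun]). *)

Set Implicit Arguments.
Unset Strict Implicit.
Unset Printing Implicit Defensive.

Import Order.TTheory GRing.Theory Num.Theory.
Import numFieldNormedType.Exports.

Local Open Scope classical_set_scope.
Local Open Scope ring_scope.

(** For [a i != 0] and any [j != i], the vector [a_i e_j - a_j e_i] is orthogonal
    to [a], and its [j]-th coordinate [a_i] is nonzero; [0 < n] provides [j]. *)
Lemma exists_nonzero_orthogonal (R : comNzRingType) (n : nat) (hn : (0 < n)%N)
    (a : 'I_n.+1 -> R) (i : 'I_n.+1) (ai : a i != 0) :
  exists2 w : 'I_n.+1 -> R, exists j, w j != 0 & \sum_k a k * w k = 0.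
Proof.
pose j := lift i (Ordinal hn).
have ij : i != j := neq_lift i (Ordinal hn).
exists (fun k => a i *+ (k == j) - a j *+ (k == i)).
  by exists j; rewrite eqxx (eq_sym j) (negbTE ij) subr0.
have pick b c : \sum_k a k * (c *+ (k == b)) = a b * c.
  rewrite (bigD1 b) //= eqxx big1 ?addr0 // => k /negbTE ->.
  by rewrite mulr0.
under eq_bigr do rewrite mulrBr.
by rewrite sumrB !pick mulrC subrr.
Qed.

Definition affine_fun (R : realType) (m : nat) (a : 'I_m -> R) (c : R)
  (x : 'rV[R]_m) : R := \sum_i a i * x 0 i + c.

Section AffineSmooth.
Variables (R : realType) (m : nat).
Implicit Types (a : 'I_m -> R) (c : R) (x v : 'rV[R]_m).

Lemma affine_fun_continuous a c : continuous (affine_fun a c).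
Proof.
have linc : continuous (fun y : 'rV[R]_m => \sum_i a i * y 0 i).
  apply: continuous_big => [|i _ y]; first exact: add_continuous.
  by apply: continuousM; [exact: cst_continuous | exact: coord_continuous].
by move=> x; apply: (continuousD (linc x)); exact: cst_continuous.
Qed.

(** The difference quotient is exactly the linear part [affine_fun a 0] at [v],
    for every nonzero increment, so that no limit has to be computed. *)
Lemma is_derive_affine_fun a c x v :
  is_derive x v (affine_fun a c) (affine_fun a 0 v).
Proof.
have quot : (fun h => h^-1 *: ((affine_fun a c \o shift x) (h *: v)
    - affine_fun a c x)) @ 0^' --> affine_fun a 0 v.
  apply: cvg_near_cst; near=> h.
  have h0 : h != 0 by near: h; exact: nbhs_dnbhs_neq.
  rewrite /affine_fun /= addr0 opprD addrACA subrr addr0 -sumrB.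
  rewrite scaler_sumr; apply: eq_bigr => i _.
  by rewrite !mxE -mulrBr addrK /GRing.scale /= mulrCA mulKf.
by apply: DeriveDef; [apply/cvg_ex; eexists; exact: quot | exact/cvg_lim].
Unshelve. all: by end_near. Qed.

(** Affine functions form a class closed under partial derivatives, all of whose
    members are continuous and derivable; this settles all orders at once. *)
Lemma smooth_affine_fun a c : smooth_on setT (affine_fun a c).
Proof.
move=> s x _.
have [b [d ->]] : exists b d, iter_partial s (affine_fun a c) = affine_fun b d.
  elim: s => [|i s [b [d /= ->]]]; first by exists a, c.
  (* The partial derivative is constant, hence affine with zero linear part. *)
  exists (fun=> 0), (affine_fun b 0 (delta_mx 0 i)); apply/funext => y.
  rewrite (@derive_val _ _ _ _ _ _ _ (is_derive_affine_fun b d y _)).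
  by rewrite [RHS]/affine_fun big1 ?add0r // => k _; rewrite mul0r.
split=> [|i]; first exact: affine_fun_continuous.
by have [] := is_derive_affine_fun b d x (delta_mx 0 i).
Qed.

End AffineSmooth.

Lemma constant_on_interval (R : realType) (J : set R) (g : R -> R) :
  is_interval J -> (forall t, J t -> is_derive t 1 g 0) ->
  forall s t, J s -> J t -> g s = g t.
Proof.
move=> Jitv g0 s t; wlog st : s t / s <= t => [th Js Jt|Js Jt].
  by have [/th|/ltW /th] := leP s t => [|e]; [exact | exact/esym/e].
have Jst u : u \in `[s, t] -> J u by rewrite in_itv; exact: Jitv.
have gst u : u \in `]s, t[ -> is_derive u 1 g 0.
  by move=> /subset_itv_oo_cc/Jst; exact: g0.
have gc : {within `[s, t], continuous g}.
  by apply: derivable_within_continuous => u /Jst/g0 [].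
have [c _] := MVT_segment st gst gc.
by rewrite mul0r => /eqP; rewrite subr_eq0 => /eqP.
Qed.

(** By the chain rule, the derivative along the curve is the scalar product of
    the gradient [a] with the field, which is the sum assumed to vanish. *)
Lemma solution_curve_affine_fun (R : realType) (m : nat) (chi : vfield R m)
    (a : 'I_m -> R) (c : R) (J : set R) (gamma : R -> 'rV[R]_m) :
  (forall x, \sum_k a k * peval (chi k) x = 0) -> solution_curve chi J gamma ->
  forall s t, J s -> J t -> affine_fun a c (gamma s) = affine_fun a c (gamma t).
Proof.
move=> chia [_ Jitv sol].
apply: (constant_on_interval (g := affine_fun a c \o gamma)) => // t Jt.
have -> : affine_fun a c \o gamma =
    (\sum_(k < m) (a k \*: (fun s => gamma s 0 k))) + cst c.
  by apply/funext => u; rewrite fctE fct_sumE.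
rewrite -(chia (gamma t)) -[X in is_derive _ _ _ X]addr0.
have suma : is_derive t 1 (\sum_(k < m) (a k \*: (fun s => gamma s 0 k)))
    (\sum_(k < m) a k *: peval (chi k) (gamma t)).
  by apply: is_derive_sum => k; apply: is_deriveZ; exact: sol.
exact: (is_deriveD suma (is_derive_cst c t 1)).
Qed.

Definition sphere_times (R : realType) (n : nat) (w : 'I_n.+1 -> R) :
  vfield R n.+1 := fun k => mconst n.+1 (w k) * sphere_poly R n.

(** The cofactor is [w] applied to the sphere polynomial, that is
    [2 (w_1 x_1 + ... + w_(n+1) x_(n+1))]; it need not be computed. *)
Lemma vfield_on_sphere_times (R : realType) (n : nat) (w : 'I_n.+1 -> R) :
  vfield_on_sphere (sphere_times w).
Proof.
exists (vf_apply (fun k => mconst n.+1 (w k)) (sphere_poly R n)).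
rewrite /vf_apply mulr_suml; apply: eq_bigr => k _.
by rewrite /sphere_times mulrAC.
Qed.

(** Its value at the origin is [-1]. *)
Lemma sphere_poly_neq0 (R : realType) (n : nat) : sphere_poly R n != 0.
Proof.
apply: contraTneq (oner_neq0 R) => S0.
have : peval (sphere_poly R n) 0 = 0 by rewrite S0 /peval mpoly.meval0.
rewrite /peval /sphere_poly mpoly.mevalB mpoly.meval1 rmorph_sum /=.
rewrite big1 => [|i _]; last first.
  by rewrite rmorphXn /= mpoly.mevalXU mxE expr0n.
by rewrite sub0r => /eqP; rewrite oppr_eq0 => ->.
Qed.

Theorem theorem3p3 (R : realType) (n : nat) (hn : (0 < n)%N)
    (f : mpoly.mpoly n.+1 R) (hf : linear_poly f) :
  exists chi : vfield R n.+1,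
    (exists i : 'I_n.+1, chi i != 0%R) /\
    vfield_on_sphere chi /\
    first_integral chi setT (peval f).
Proof.
have [a [c [[i ai] fE]]] := hf.
have pfE : peval f = affine_fun a c.
  apply/funext => x; rewrite fE /peval mpoly.mevalD mpoly.mevalC rmorph_sum /=.
  congr (_ + _); apply: eq_bigr => k _.
  by rewrite mpoly.mevalM mpoly.mevalC mpoly.mevalXU.
have [w [j wj] aw] := exists_nonzero_orthogonal hn ai.
exists (sphere_times w); split; last split.
- exists j; rewrite mulf_neq0 ?sphere_poly_neq0 //.
  by rewrite mpoly.mpolyC_eq0.
- exact: vfield_on_sphere_times.
rewrite pfE; split => //.
- exact: openT.
- (* The two values are [c] and [a i + c]. *)
  exists 0, (delta_mx 0 i); split => //.
  rewrite /affine_fun; move/addIr/eqP; apply/negP.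
  rewrite big1 => [|k _]; last by rewrite mxE mulr0.
  rewrite (bigD1 i) //= mxE !eqxx mulr1 big1 ?addr0 1?eq_sym // => k /negbTE ki.
  by rewrite mxE ki andbF mulr0.
- exact: smooth_affine_fun.
- move=> J gamma sol _; apply: solution_curve_affine_fun sol => x.
  under eq_bigr do rewrite /peval mpoly.mevalM mpoly.mevalC mulrA.
  by rewrite -mulr_suml aw mul0r.
Qed.
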